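(* Let $G=(V,E)$ be a connected undirected graph with $n=|V|$ and real edge weights $(w_{ij})_{\{i,j\}\in E}$, let $G_F=(V,F)$ be a chordal extension of $G$, let $\mathcal{K}=\{C_1,\dots,C_l\}$ be the set of all maximal cliques of $G_F$, and let $k$ be an integer with $2\le k\le n$. The edge formulation (A) and the clique-based formulation (B) of the minimum $k$-partition problem (both defined in the context) are equivalent in the following sense: for any feasible solution of (A) there exists a feasible solution of (B) with the same objective value; conversely, for any feasible solution $x_F\in\{0,1\}^F$ of (B) there exists a vector extending $x_F$ (i.e. a vector in $\{0,1\}^{V^2}$ whose components indexed by $F$ are those of $x_F$) that is feasible for (A).
   Context: All graphs are finite, simple and undirected. A graph is chordal if every cycle of length at least $4$ has a chord (an edge joining two nonconsecutive vertices of the cycle). A chordal extension of $G=(V,E)$ is a chordal graph $G_F=(V,F)$ with $E\subseteq F$. Cliques are identified with their vertex sets $C_r\subseteq V$; a clique is maximal if its vertex set is not a proper subset of another clique. The vertex set $V$ is totally ordered, and $V^2:=\{\{i,j\}\subseteq V: i<j\}$ denotes the set of edges of the complete graph on $V$, so $E\subseteq F\subseteq V^2$. Vectors are indexed by unordered pairs, so $x_{ij}=x_{ji}$. Formulation (A) (edge formulation): minimize $\sum_{\{i,j\}\in E} w_{ij}x_{ij}$ over $x\in\{0,1\}^{V^2}$ subject to $x_{ih}+x_{hj}-x_{ij}\le 1$ for all pairwise distinct $i,j,h\in V$, and $\sum_{i,j\in Q:\, i<j} x_{ij}\ge 1$ for all $Q\subseteq V$ with $|Q|=k+1$. Formulation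 (B) (clique-based reformulation): minimize $\sum_{\{i,j\}\in E} w_{ij}x_{ij}$ over $x\in\{0,1\}^{F}$ subject to $x_{ih}+x_{hj}-x_{ij}\le 1$ for all pairwise distinct $i,j,h\in C_r$, $r=1,\dots,l$, and $\sum_{i,j\in Q:\, i<j} x_{ij}\ge 1$ for all $Q\subseteq C_r$ with $|Q|=k+1$, $r=1,\dots,l$. *)

(* Defs.v *)
From mathcomp Require Import all_boot all_order all_algebra.
From mathcomp Require Import reals.

Set Implicit Arguments.
Unset Strict Implicit.
Unset Printing Implicit Defensive.

Import Order.TTheory GRing.Theory Num.Theory.
Local Open Scope ring_scope.

Section Graphs.

Variables (d : Order.disp_t) (V : finOrderType d).
Implicit Types (S : {set {set V}}) (A : {set V}).

Definition complete_edges : {set {set V}} :=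
  [set e | [exists i : V, exists j : V, (i < j)%O && (e == [set i; j])]].

(* A simple graph on V is given by its edge set S \subset complete_edges; as
   [set i; i] is a singleton, adjacency is then irreflexive. *)
Definition adj S : rel V := fun i j => [set i; j] \in S.

Definition connected S : Prop := forall i j : V, connect (adj S) i j.

Definition chordal S : Prop :=
  forall c : seq V, ucycle (adj S) c -> (4 <= size c)%N ->
  exists u v : V,
    [/\ u \in c, v \in c, v != next c u, u != next c v & adj S u v].

Definition chordal_extension (E F : {set {set V}}) : Prop :=
  [/\ F \subset complete_edges, E \subset F & chordal F].

Definition clique S A : bool :=
  [forall i in A, forall j in A, (i != j) ==> adj S i j].

Definition maxcliques S : {set {set V}} := [set A | maxset (clique S) A].

End Graphs.

Section Partition.

Variables (d : Order.disp_t) (V : finOrderType d).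
Implicit Types (S E F : {set {set V}}).

Definition binvec S := {ffun {e : {set V} | e \in S} -> bool}.

(* The component of x at the unordered pair e, as an integer. The value 0 for
   e \notin S is a default that the constraints and objectives below never
   read: they only use pairs of S. *)
Definition component S (x : binvec S) (e : {set V}) : int :=
  if insub e is Some u then (x u : nat)%:Z else 0.

Definition triangle_ineqs S (x : binvec S) (A : {set V}) : Prop :=
  forall i j h : V, i \in A -> j \in A -> h \in A ->
    i != j -> i != h -> j != h ->
    component x [set i; h] + component x [set h; j] - component x [set i; j] <= 1.

Definition clique_ineqs (k : nat) S (x : binvec S) (A : {set V}) : Prop :=
  forall Q : {set V}, Q \subset A -> #|Q| = k.+1 ->
    1 <= \sum_(i in Q) \sum_(j in Q | (i < j)%O) component x [set i; j].

Definition feasibleA (k : nat) (x : binvec (complete_edges V)) : Prop :=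
  triangle_ineqs x [set: V] /\ clique_ineqs k x [set: V].

Definition feasibleB (k : nat) F (x : binvec F) : Prop :=
  forall C : {set V}, C \in maxcliques F ->
    triangle_ineqs x C /\ clique_ineqs k x C.

Definition objective (R : realType) E (w : {e : {set V} | e \in E} -> R)
    S (x : binvec S) : R :=
  \sum_(e : {e : {set V} | e \in E}) w e * (component x (val e))%:~R.

End Partition.

(* Main.v *)
(** A feasible solution of (B) is, on every clique of the chordal extension, an
    equivalence relation with at most [k] classes.  A chordal graph has a
    perfect elimination order (Dirac: every nonempty induced subgraph has a
    simplicial vertex), and colouring greedily along it yields [c : V -> 'I_k]
    such that the given vector is the indicator of [c i = c j] on [F].  The
    indicator of [c i = c j] on all pairs is the required extension; the clique
    inequalities then hold by the pigeonhole principle.  Conversely, a solution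
    of (A) is restricted to [F]. *)
Require Import Defs.
From mathcomp Require Import all_boot all_order all_algebra.
From mathcomp Require Import reals.
From mathcomp Require Import zify.

Set Implicit Arguments.
Unset Strict Implicit.
Unset Printing Implicit Defensive.

Import Order.TTheory GRing.Theory Num.Theory.
Local Open Scope ring_scope.

(** * Simplicial vertices in chordal graphs *)

Section Simplicial.

Variables (d : Order.disp_t) (V : finOrderType d) (F : {set {set V}}).
Hypothesis F_simple : F \subset complete_edges V.

Lemma adj_sym : symmetric (adj F).
Proof. by move=> i j; rewrite /adj setUC. Qed.

Lemma complete_edgesP (e : {set V}) :
  reflect (exists i j : V, i != j /\ e = [set i; j]) (e \in complete_edges V).
Proof.
rewrite inE; apply: (iffP existsP) => [[i /existsP[j /andP[lt_ij /eqP->]]]|].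
  by exists i, j; rewrite (lt_eqF lt_ij).
case=> i [j [ne_ij ->]].
case: (ltgtP i j) ne_ij => // lt_ij _; [exists i | exists j]; apply/existsP.
  by exists j; rewrite lt_ij eqxx.
by exists i; rewrite lt_ij setUC eqxx.
Qed.

Lemma adj_irr i : adj F i i = false.
Proof.
apply/negP => /(subsetP F_simple) /complete_edgesP[a [b [ne_ab eq_i]]].
have : #|[set i; i]| = #|[set a; b]| by rewrite eq_i.
by rewrite !cards2 eqxx ne_ab.
Qed.

Lemma adj_neq i j : adj F i j -> i != j.
Proof. by apply: contraTneq => ->; rewrite adj_irr. Qed.

Hypothesis F_chordal : chordal F.

(* A chord of the cycle [v :: q] cannot be incident to [v], so it shortcuts
   [q]; iterating, [q] shrinks to the edge from [x] to [y]. *)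
Lemma adj_ends_of_path (v x y : V) (q : seq V) :
  adj F v x -> adj F v y -> x != y -> v \notin q -> uniq q ->
  sorted (adj F) q -> head v q = x -> last v q = y ->
  (forall z, z \in q -> adj F v z -> z = x \/ z = y) -> adj F x y.
Proof.
move=> vx vy ne_xy.
have [n] := ubnP (size q); elim: n q => // n IHn q.
rewrite ltnS => szq vq Uq Sq hq lq Nq.
(* Cutting out [q2] along the edge from [a] to [b] keeps both ends of the path; [q2] being nonempty
   makes the size drop. *)
have shorter q1 a q2 b q3 :
    q = q1 ++ a :: q2 ++ b :: q3 -> adj F a b -> q2 != [::] -> adj F x y.
  move=> def_q ab q2n0.
  have sub : subseq (q1 ++ a :: b :: q3) q.
    rewrite def_q cat_subseq //= eqxx.
    by rewrite -[b :: q3]cat0s cat_subseq ?sub0seq.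
  apply: (IHn (q1 ++ a :: b :: q3)).
  - apply: leq_trans szq; rewrite def_q !size_cat /= size_cat /=.
    by case: q2 q2n0 {def_q sub} => //= *; lia.
  - by apply: contra vq => /(mem_subseq sub).
  - exact: subseq_uniq sub Uq.
  - move: Sq; rewrite def_q; case: q1 {def_q sub} => [|z q1] /=;
      rewrite ?cat_path /= ?cat_path /= ab.
      by case/and3P=> _ _ ->.
    by case/and5P=> -> -> _ _ ->.
  - by rewrite -hq def_q; case: (q1).
  - by rewrite -lq def_q !last_cat /= last_cat.
  - by move=> z zq'; apply: Nq; apply: mem_subseq sub z zq'.
case: q szq vq Uq Sq hq lq Nq shorter => [|x' p] szq vq Uq Sq hq lq Nq shorter.
  by move: vx; rewrite -hq /= adj_irr.
move: hq => /= hq; subst x'.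
(* One vertex would force [x = y], and two form the desired edge; from three on, [v] closes [q] to a
   cycle of length at least 4. *)
case: p szq vq Uq Sq lq Nq shorter => [|a [|b p]] szq vq Uq Sq lq Nq shorter.
- by move: ne_xy; rewrite -lq /= eqxx.
- by move: Sq lq => /= /andP[+ _] <-.
set q := [:: x, a, b & p] in szq vq Uq Sq lq Nq shorter.
have Ucyc : ucycle (adj F) (v :: q).
  rewrite /ucycle /ucycleb cons_uniq vq Uq andbT /cycle rcons_path.
  rewrite lq (adj_sym y) vy !andbT -[path _ _ _]/(adj F v x && sorted (adj F) q).
  by rewrite vx Sq.
have [//|u [w [uc wc nwu nuw uw]]] := F_chordal Ucyc.
(* The default [v] of [nth] is the true successor of the last vertex of [q], where the cycle
   closes. *)
have nextE z : z \in q -> next (v :: q) z = nth v q (index z q).+1.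
  move=> zq; rewrite next_nth inE zq orbT /=.
  by case: eqP zq vq => [<- ->|].
have nextv : next (v :: q) v = x by rewrite next_nth mem_head /= eqxx.
have v_isolated z : z \in v :: q -> adj F v z -> v != next (v :: q) z ->
    z != next (v :: q) v -> False.
  rewrite inE => /predU1P[->|zq vz]; first by rewrite adj_irr.
  rewrite nextE // nextv; case: (Nq z zq vz) => -> {z zq vz}; last first.
    have -> : index y q = (size q).-1 by rewrite -lq -nth_last index_uniq.
    by rewrite nth_default ?eqxx.
  by rewrite eqxx.
have [uv|nuv] := eqVneq u v; first by subst u; case: (v_isolated w).
have [wv|nwv] := eqVneq w v.
  by subst w; rewrite adj_sym in uw; case: (v_isolated u).
move: uc wc; rewrite !inE (negPf nuv) (negPf nwv) /= -!in_cons -/q => uq wq.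
rewrite nextE // in nwu; rewrite nextE // in nuw.
(* Since [t] comes after [s] but is not its successor, the segment strictly between them is nonempty
   and can be cut out. *)
have chord s t : s \in q -> t \in q -> (index s q < index t q)%N ->
    t != nth v q (index s q).+1 -> adj F s t -> adj F x y.
  move=> sq tq lt_st nts st.
  have := cat_take_drop (index s q) q; rewrite (drop_nth v) ?index_mem //.
  rewrite nth_index // => def_q.
  set j := (index t q - (index s q).+1)%N.
  have ltj : (j < size (drop (index s q).+1 q))%N.
    by rewrite size_drop ltn_sub2r ?index_mem // (leq_ltn_trans lt_st) ?index_mem.
  apply: (shorter (take (index s q) q) s (take j (drop (index s q).+1 q)) t
     (drop j.+1 (drop (index s q).+1 q))) => //.
    rewrite -{1}def_q -{1}(cat_take_drop j (drop (index s q).+1 q)).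
    by rewrite (drop_nth v ltj) nth_drop subnKC // nth_index.
  rewrite -size_eq0 size_take ltj subn_eq0 -ltnNge ltn_neqAle lt_st andbT.
  by apply: contra nts => /eqP->; rewrite nth_index.
case: (ltngtP (index u q) (index w q)) => [lt|lt|].
- exact: (chord u w).
- by apply: (chord w u); rewrite // adj_sym.
move=> eq_uw; have : u = w by rewrite -(nth_index v uq) eq_uw nth_index.
by move/eqP; rewrite (negPf (adj_neq uw)).
Qed.

Definition simplicial (W : {set V}) (v : V) : bool :=
  clique F [set u in W | adj F v u].

Lemma cliqueP (S : {set {set V}}) (A : {set V}) :
  reflect {in A &, forall i j, i != j -> adj S i j} (clique S A).
Proof.
apply: (iffP forallP) => [cl i j iA jA ne|cl i].
  by have /implyP/(_ iA)/forallP/(_ j)/implyP/(_ jA)/implyP := cl i; apply.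
apply/implyP => iA; apply/forallP => j; apply/implyP => jA.
by apply/implyP; apply: cl.
Qed.

Lemma cliqueS (S : {set {set V}}) (A B : {set V}) :
  A \subset B -> clique S B -> clique S A.
Proof.
by move=> /subsetP AB /cliqueP cB; apply/cliqueP => i j /AB iB /AB; apply: cB.
Qed.

(* With [C] a component of [W] minus the closed neighbourhood of [v] and [S]
   its attachment set, [S] is a clique, so the inductive hypothesis applied to
   [C :|: S] produces a vertex of [C]. *)
Lemma exists_simplicial_nonadj (W : {set V}) (v u : V) :
  v \in W -> u \in W -> u != v -> ~~ adj F v u ->
  exists s, [/\ s \in W, s != v, ~~ adj F v s & simplicial W s].
Proof.
have [n] := ubnP #|W|; elim: n W v u => // n IHn W v u.
rewrite ltnS => leW vW uW nuv vu.
pose M := [set z in W | (z != v) && ~~ adj F v z].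
pose r := [rel a b : V | [&& adj F a b, a \in M & b \in M]].
have r_sym : connect_sym r.
  by apply: sym_connect_sym => a b /=; rewrite adj_sym [(a \in M) && _]andbC.
pose C := [set z | connect r u z].
pose S := [set z in W :\: C | [exists c in C, adj F z c]].
have uM : u \in M by rewrite inE uW nuv.
have uC : u \in C by rewrite inE connect0.
have connM a b : a \in M -> connect r a b -> b \in M.
  move=> aM /connectP[p pth ->]; elim: p a aM pth => //= c p IHp a _.
  by case/andP=> /and3P[_ _ cM]; apply: IHp.
have CM z : z \in C -> z \in M by rewrite inE; apply: connM.
have CW z : z \in C -> z \in W by move/CM; rewrite inE => /andP[].
(* A vertex of [M] adjacent to the component [C] would belong to [C]; and [v] itself has no
   neighbour in [C]. *)
have SNv z : z \in S -> adj F v z /\ z \notin M.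
  rewrite 3!inE => /andP[/andP[zC zW] /existsP[c /andP[cC zc]]].
  have zM : z \notin M.
    apply: contra zC => zM; move: (cC); rewrite !inE => uc.
    by apply: connect_trans uc (connect1 _); rewrite /= adj_sym zc zM CM.
  split=> //; apply: contraNT zM => vz; rewrite inE zW vz andbT.
  apply: contraTneq zc => ->; by have := CM _ cC; rewrite inE => /and3P[].
(* Two vertices of [S] are joined by a path with interior in [M], hence with no interior neighbour
   of [v], so [adj_ends_of_path] applies. *)
have S_clique : clique F S.
  apply/cliqueP => x y xS yS ne_xy.
  have [vx xM] := SNv _ xS; have [vy yM] := SNv _ yS.
  have [cx cxC xcx] : exists2 c, c \in C & adj F x c.
    by move: xS; rewrite inE => /andP[_ /existsP[c /andP[? ?]]]; exists c.
  have [cy cyC ycy] : exists2 c, c \in C & adj F y c.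
    by move: yS; rewrite inE => /andP[_ /existsP[c /andP[? ?]]]; exists c.
  have : connect r cx cy.
    move: cxC cyC; rewrite !inE => ux uy; apply: connect_trans uy.
    by rewrite r_sym.
  case/connectP => p0 pth0 lst0.
  case: (shortenP pth0) lst0 => p pth Up _ lst {p0 pth0}.
  have pM z : z \in cx :: p -> z \in M.
    move=> zp; apply: (connM cx); first exact: CM.
    exact: (path_connect pth).
  have notin_p z : z \notin M -> z \notin cx :: p by apply: contra => /pM.
  have vM : v \notin M by rewrite inE eqxx andbF.
  apply: (@adj_ends_of_path v x y (x :: rcons (cx :: p) y)) => //.
  - by rewrite in_cons mem_rcons in_cons 2!negb_or (adj_neq vx) (adj_neq vy) notin_p.
  - rewrite cons_uniq rcons_uniq Up mem_rcons in_cons negb_or ne_xy.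
    by rewrite !notin_p.
  - rewrite /= xcx rcons_path -lst adj_sym ycy andbT.
    by apply: sub_path pth => a b /= /andP[].
  - by rewrite /= last_rcons.
  - move=> z; rewrite inE mem_rcons inE => /or3P[/eqP->|/eqP->|/pM]; [by left|by right|].
    by rewrite inE => /and3P[_ _ /negPf->].
pose W' := C :|: S.
have W'W z : z \in W' -> z \in W.
  by rewrite !inE => /orP[|/andP[/andP[_ ->]]] // uz; apply: CW; rewrite inE.
have vW' : v \notin W'.
  apply/negP => /setUP[/CM|/SNv[]]; first by rewrite inE eqxx andbF.
  by rewrite adj_irr.
have ltW' : (#|W'| < n)%N.
  apply: leq_trans leW; apply: proper_card; apply/properP; split.
    by apply/subsetP.
  by exists v.
(* All neighbours in [W] of a vertex of [C] lie in [W'], by the choice of [S]. *)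
have lift s : s \in C -> simplicial W' s ->
    exists s, [/\ s \in W, s != v, ~~ adj F v s & simplicial W s].
  move=> sC simp; exists s.
  have := CM _ sC; rewrite inE => /and3P[-> -> ->]; split=> //.
  apply: cliqueS simp; apply/subsetP => z; rewrite inE => /andP[zW sz].
  rewrite inE sz andbT inE; have [//|zC] := boolP (z \in C).
  rewrite /= in_set in_setD zC zW /=; apply/existsP; exists s.
  by rewrite sC adj_sym.
have [W'cl|W'ncl] := boolP (clique F W').
  apply: (lift u) => //; apply: cliqueS W'cl.
  by apply/subsetP => z; rewrite inE => /andP[].
pose nonuniv z := [exists t in W', (t != z) && ~~ adj F z t].
have IH z : z \in W' -> nonuniv z ->
    exists s, [/\ s \in W', s != z, ~~ adj F z s & simplicial W' s].
  move=> zW' /existsP[t /and3P[tW' ntz zt]].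
  exact: (IHn W' z t).
(* The simplicial vertex found must avoid [S]. If [z] is in [S], nonadjacency to [z] ensures this,
   as [S] is a clique; if every vertex of [S] is adjacent to all the rest of [W'], nonadjacency to
   any [z] does. *)
have [/existsP[z /andP[zS nz]]|noS] := boolP [exists z in S, nonuniv z].
  have [|s [sW' nsz zs simp]] := IH z _ nz; first by rewrite inE zS orbT.
  apply: (lift s) => //; case/setUP: sW' => // sS.
  by case/negP: zs; move/cliqueP: S_clique; apply; rewrite // eq_sym.
have [z zW' nz] : exists2 z, z \in W' & nonuniv z.
  move: W'ncl; rewrite /clique negb_forall => /existsP[z].
  rewrite negb_imply negb_forall => /andP[zW' /existsP[t]].
  rewrite !negb_imply => /and3P[tW' nzt zt]; exists z => //.
  by apply/existsP; exists t; rewrite tW' eq_sym nzt.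
have [s [sW' nsz zs simp]] := IH z zW' nz.
apply: (lift s) => //; case/setUP: sW' => // sS.
case/existsP: noS; exists s; rewrite sS; apply/existsP; exists z.
by rewrite zW' eq_sym nsz adj_sym.
Qed.

(** If [v] is not simplicial, two of its neighbours in [W] are distinct and nonadjacent, which is
    the pair [exists_simplicial_nonadj] starts from. *)
Lemma exists_simplicial (W : {set V}) :
  W != set0 -> exists2 v, v \in W & simplicial W v.
Proof.
case/set0Pn=> v vW; have [|] := boolP (simplicial W v); first by exists v.
rewrite /simplicial /clique negb_forall => /existsP[a].
rewrite negb_imply inE negb_forall => /andP[/andP[aW _] /existsP[b]].
rewrite !negb_imply inE => /andP[/andP[bW _] /andP[nab ab]].
have [|s [sW _ _ simp]] := exists_simplicial_nonadj aW bW _ ab.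
  by rewrite eq_sym.
by exists s.
Qed.

End Simplicial.

(** * Colourings from feasible solutions of (B) *)

Section Colouring.

Variables (d : Order.disp_t) (V : finOrderType d).
Implicit Types (S F : {set {set V}}).

Lemma componentE S (x : binvec S) e (eS : e \in S) :
  component x e = (x (exist _ e eS) : nat)%:Z.
Proof. by rewrite /component (insubT (fun e => e \in S) eS). Qed.

(** Reading through [component] avoids carrying a proof of [F \subset S]. *)
Definition restrict S F (x : binvec S) : binvec F :=
  [ffun u => component x (val u) == 1].

Lemma component_restrict S F (x : binvec S) e :
  e \in F -> F \subset S -> component (restrict F x) e = component x e.
Proof.
move=> eF FS; rewrite componentE ffunE /= (componentE _ (subsetP FS _ eF)).
by case: (x _).
Qed.

Lemma component_bool S (x : binvec S) e :
  component x e = (component x e == 1 : nat)%:Z.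
Proof. by rewrite /component; case: insub => // u; case: (x u). Qed.

(** A sum of zeros and ones reaches 1 exactly when some term is 1; as pairs are unordered, [i < j]
    weakens to [i != j]. *)
Lemma sum_pairs_gt0P (f : {set V} -> int) (Q : {set V}) :
  (forall e, f e = (f e == 1 : nat)%:Z) ->
  reflect (exists i j, [/\ i \in Q, j \in Q, i != j & f [set i; j] == 1])
    (1 <= \sum_(i in Q) \sum_(j in Q | (i < j)%O) f [set i; j]).
Proof.
move=> fb; have f0 e : 0 <= f e by rewrite fb; case: eqP.
apply: (iffP idP) => [|[i [j [iQ jQ nij fij]]]].
  move=> sum_ge1; have [/existsP[i /existsP[j /and4P[? ? ? ?]]]|none] :=
    boolP [exists i, exists j, [&& i \in Q, j \in Q, i != j & f [set i; j] == 1]].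
    by exists i, j.
  move: sum_ge1; rewrite big1 // => i iQ; rewrite big1 // => j /andP[jQ lt_ij].
  rewrite fb; case: eqP => // /eqP fij; case/existsP: none; exists i.
  by apply/existsP; exists j; rewrite iQ jQ fij (lt_eqF lt_ij).
wlog lt_ij : i j iQ jQ nij fij / (i < j)%O.
  move=> W; case: (ltgtP i j) (nij) => // lt _; first exact: (W i j).
  by apply: (W j i) => //; [rewrite eq_sym | rewrite setUC].
rewrite (bigD1 i) //= (bigD1 j) ?jQ //= (eqP fij) -addrA lerDl addr_ge0 //.
  by apply: sumr_ge0.
by apply: sumr_ge0 => a _; apply: sumr_ge0.
Qed.

(* Colouring along a perfect elimination order: the clique inequalities leave a
   free colour for a simplicial vertex joined to none of its neighbours. *)
Lemma exists_colouring F k (x : binvec F) :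
  F \subset complete_edges V -> chordal F -> (0 < k)%N -> feasibleB k x ->
  exists c : V -> 'I_k,
    forall i j, adj F i j -> component x [set i; j] = (c i == c j : nat)%:Z.
Proof.
move=> F_simple F_chordal k_gt0 x_feas.
pose t i j := component x [set i; j] == 1.
have t_sym i j : t i j = t j i by rewrite /t setUC.
(* Every clique lies in a maximal one, whose constraints it inherits. *)
have feasK K : clique F K -> triangle_ineqs x K /\ clique_ineqs k x K.
  case/maxset_exists=> C Cmax KC.
  have [|tri cli] := x_feas C; first by rewrite inE.
  split=> [i j h /(subsetP KC) iC /(subsetP KC) jC /(subsetP KC) hC|Q QK].
    exact: tri.
  by apply: cli; apply: subset_trans KC.
have t_trans K i j h : clique F K -> i \in K -> j \in K -> h \in K ->
    i != j -> i != h -> j != h -> t i h -> t h j -> t i j.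
  case/feasK => tri _ iK jK hK nij nih njh.
  have := tri i j h iK jK hK nij nih njh.
  rewrite /t => + /eqP E1 /eqP E2.
  by rewrite E1 E2 component_bool; case: eqP.
suff [c cP] : exists c : V -> 'I_k, {in [set: V] &, forall i j,
    adj F i j -> t i j = (c i == c j)}.
  by exists c => i j ij; rewrite component_bool -cP // /t.
have [n] := ubnP #|[set: V]|; elim: n [set: V] => // n IHn W.
rewrite ltnS => leW; have [->|W0] := eqVneq W set0.
  by exists (fun=> Ordinal k_gt0) => i j; rewrite inE.
have [v vW simp] := exists_simplicial F_simple F_chordal W0.
have [|c cP] := IHn (W :\ v).
  by apply: leq_trans leW; rewrite [X in (_ < X)%N](cardsD1 v) vW.
set N := [set u in W | adj F v u] in simp.
have vN : v \notin N by rewrite inE (adj_irr F_simple) andbF.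
have NW u : u \in N -> u \in W :\ v.
  by move=> uN; rewrite in_setD1 (memPn vN _ uN); move: uN; rewrite inE => /andP[].
have Ncl : {in N &, forall i j, i != j -> adj F i j} by apply/cliqueP.
have Kcl : clique F (v |: N).
  apply/cliqueP => i j /setU1P[->|iN] /setU1P[->|jN]; rewrite ?eqxx //.
  - by move: jN; rewrite inE => /andP[].
  - by move: iN; rewrite inE adj_sym => /andP[].
  - exact: Ncl.
have tN i j : i \in N -> j \in N -> i != j -> t i j = (c i == c j).
  by move=> iN jN nij; apply: cP; rewrite ?NW // Ncl.
have NK u : u \in N -> u \in v |: N by move=> uN; rewrite inE uN orbT.
(* If [v] is joined by [t] to some [u] in [N], the colour of [u] is consistent by transitivity of
   [t] on [v |: N]; otherwise a colour absent from [N] is needed. *)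
have [a aP] : exists a : 'I_k, forall u, u \in N -> t v u = (a == c u).
  have [/existsP[u /andP[uN vu]]|none] := boolP [exists u in N, t v u].
    exists (c u) => w wN; have [<-|nuw] := eqVneq u w; first by rewrite eqxx.
    have nuv : u != v by apply: contraNneq vN => <-.
    have nwv : w != v by apply: contraNneq vN => <-.
    have nvw : v != w by rewrite eq_sym.
    have nvu : v != u by rewrite eq_sym.
    have nwu : w != u by rewrite eq_sym.
    have uv : t u v by rewrite t_sym.
    rewrite -tN //; apply/idP/idP => h.
      by apply: (t_trans _ u w v Kcl); rewrite ?setU11 ?NK.
    by apply: (t_trans _ v w u Kcl); rewrite ?setU11 ?NK.
  have [/forallP full|] := boolP [forall a, a \in c @: N]; last first.
    rewrite negb_forall => /existsP[a aN]; exists a => u uN.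
    have /negPf-> : ~~ t v u by apply: contra none => vu; apply/existsP; exists u; rewrite uN.
    by apply/esym/negbTE; apply: contra aN => /eqP->; apply: imset_f.
  (* If all [k] colours occurred on [N], one representative of each together with [v] would be
     [k.+1] clique vertices with no pair in relation [t], against the clique inequality. *)
  pose rep a := odflt v [pick u in N | c u == a].
  have repP a : rep a \in N /\ c (rep a) = a.
    rewrite /rep; case: pickP => [u /andP[uN /eqP]|none_a] //=.
    by case/imsetP: (full a) => u uN eq_a; have := none_a u; rewrite uN eq_a eqxx.
  have rep_inj : injective rep by apply: (can_inj (g := c)) => a; case: (repP a).
  have repN u : u \in rep @: [set: 'I_k] -> u \in N.
    by case/imsetP=> a _ ->; case: (repP a).
  have RK : v |: rep @: [set: 'I_k] \subset v |: N.
    by apply: setUS; apply/subsetP.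
  have cardR : #|v |: rep @: [set: 'I_k]| = k.+1.
    by rewrite cardsU1 card_imset // cardsT card_ord (contra (repN v)).
  have [_ /(_ _ RK cardR) /(sum_pairs_gt0P _ (component_bool x))] := feasK _ Kcl.
  case=> i [j [+ + nij]]; rewrite -/(t i j).
  have tv u : u \in N -> t v u = false.
    by move=> uN; apply: contraNF none => vu; apply/existsP; exists u; rewrite uN.
  move=> /setU1P[iv|iR] /setU1P[jv|jR].
  - by move: nij; rewrite iv jv eqxx.
  - by rewrite iv tv ?repN.
  - by rewrite jv t_sym tv ?repN.
  rewrite tN ?repN // => /eqP eq_c; case/imsetP: iR nij eq_c => a _ ->.
  case/imsetP: jR => b _ ->; rewrite !(proj2 (repP _)) => + ab.
  by rewrite ab eqxx.
exists (fun u => if u == v then a else c u) => i j iW jW ij.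
have [iv|niv] := eqVneq i v; have [jv|njv] := eqVneq j v.
- by move: ij; rewrite iv jv (adj_irr F_simple).
- by rewrite iv aP // inE jW -iv.
- by rewrite jv t_sym aP 1?eq_sym // inE iW -jv adj_sym.
- by apply: cP; rewrite // in_setD1 ?niv ?njv.
Qed.

End Colouring.

(** * Transfer of solutions between (A) and (B) *)

Theorem corollary1 (R : realType) (d : Order.disp_t) (V : finOrderType d)
    (E F : {set {set V}}) (w : {e : {set V} | e \in E} -> R) (k : nat)
    (E_simple : E \subset complete_edges V)
    (E_connected : connected E)
    (F_ext : chordal_extension E F)
    (k_bounds : (2 <= k <= #|V|)%N) :
  (forall x : binvec (complete_edges V), feasibleA k x ->
     exists xF : binvec F,
       feasibleB k xF /\ objective w xF = objective w x)
  /\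
  (forall xF : binvec F, feasibleB k xF ->
     exists x : binvec (complete_edges V),
       (forall e : {set V}, e \in F -> component x e = component xF e)
       /\ feasibleA k x).
Proof.
have [F_simple EF F_chordal] := F_ext.
split=> [x [tri cli]|xF xF_feas].
  exists (restrict F x); split; last first.
    apply: eq_bigr => e _; rewrite component_restrict //.
    exact: subsetP EF _ (valP e).
  move=> C; rewrite inE => /maxsetp/cliqueP Ccl.
  have resE i j : i \in C -> j \in C -> i != j ->
      component (restrict F x) [set i; j] = component x [set i; j].
    by move=> iC jC nij; apply: component_restrict => //; apply: Ccl.
  split=> [i j h iC jC hC nij nih njh|Q QC cardQ].
    by rewrite !resE // 1?eq_sym //; apply: tri; rewrite ?inE.
  rewrite (eq_bigr (fun i => \sum_(j in Q | (i < j)%O) component x [set i; j])).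
    by apply: cli; rewrite ?subsetT.
  move=> i iQ; apply: eq_bigr => j /andP[jQ lt_ij].
  by rewrite resE ?(subsetP QC) // (lt_eqF lt_ij).
have k_gt0 : (0 < k)%N by case/andP: k_bounds => /ltnW.
have [c cP] := exists_colouring F_simple F_chordal k_gt0 xF_feas.
(* An edge is a set without distinguished ends, so equality of end colours is stated as constancy of
   [c] on it. *)
pose x : binvec (complete_edges V) :=
  [ffun e : {e | e \in complete_edges V} =>
     [forall i in val e, forall j in val e, c i == c j]].
have xE i j : i != j -> component x [set i; j] = (c i == c j : nat)%:Z.
  move=> nij; have ij : [set i; j] \in complete_edges V.
    by apply/complete_edgesP; exists i, j.
  rewrite componentE ffunE /=; congr (nat_of_bool _)%:Z.
  apply/forallP/eqP => [mono|eq_c a].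
    have /implyP/(_ (set21 i j))/forallP/(_ j)/implyP/(_ (set22 i j))/eqP := mono i.
    by [].
  apply/implyP => /set2P[] ->; apply/forallP => b; apply/implyP => /set2P[] ->;
    by rewrite ?eq_c.
exists x; split=> [e eF|].
  have /complete_edgesP[i [j [nij eij]]] := subsetP F_simple _ eF.
  by rewrite eij xE // cP // /adj -eij.
split=> [i j h _ _ _ nij nih njh|Q _ cardQ].
  have nhj : h != j by rewrite eq_sym.
  rewrite !xE //.
  by case: (c i =P c h) => [->|_]; case: (c h =P c j) => _ //; case: (c i == c j).
apply/sum_pairs_gt0P; first exact: component_bool.
(* Pigeonhole: [k.+1] vertices and [k] colours. *)
have [/dinjectiveP c_inj|/dinjectivePn[i iQ [j /andP[nij jQ] eq_c]]] :=
    boolP (dinjectiveb c Q).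
  have := max_card (c @: Q).
  by rewrite card_in_imset // cardQ card_ord ltnn.
by exists i, j; rewrite xE 1?eq_sym // eq_c eqxx.
Qed.
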